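(* Let $k>0$ be an arbitrary wave number, let $L$ be the length of the unit cell, and let $\lambda_1(k)$ and $\lambda_2(k)$ be the eigenvalues of the modified transfer matrix $T(k)$. Then, for $i=1,2$, the eigenmode $u_i$ associated with $\lambda_i(k)$ satisfies $$u_i(x+L)=e^{\mathrm{i}(\alpha(k)+\mathrm{i}\beta(k))L}\,u_i(x),$$ with $$\beta(k)=-\frac1L\log\bigl(|\lambda_i(k)|\bigr),\qquad \alpha(k)=\frac1L\arg\bigl(\lambda_i(k)\bigr).$$
   Context: Unit cell and infinite chain: let $Y\subset\mathbb{R}$ be an interval of length $L>0$ containing $N$ disjoint intervals (resonators) $D_j=(x_j^{\mathsf L},x_j^{\mathsf R})$, $1\le j\le N$, with $x_j^{\mathsf L}<x_j^{\mathsf R}<x_{j+1}^{\mathsf L}$, and $D=\bigcup_j D_j$. The infinite chain is the $L$-periodic repetition of $D$. Let $v>0$ be the wave speed outside the resonators, $v_j>0$ the wave speed in $D_j$, $\delta>0$ the contrast, $\omega>0$ the frequency and $k=\omega/v$. The wave equation is: $u''+\frac{\omega^2}{v^2}u=0$ outside the resonators, $u''+\frac{\omega^2}{v_j^2}u=0$ in $D_j$, $u$ continuous across every endpoint, and at each endpoint the one-sided derivative of $u$ from inside the resonator equals $\delta$ times the one-sided derivative from outside (and likewise for all translates by multiples of $L$). Transfer matrix: consider the general solution of this equation for the resonators $D_1,\dots,D_N$ alone. It has the form $u(x)=Ae^{\mathrm{i}kx}+Be^{-\mathrm{i}kx}$ for $x<x_1^{\mathsf L}$ and $u(x)=Ce^{\mathrm{i}kx}+De^{-\mathrm{i}kx}$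 for $x>x_N^{\mathsf R}$. The transfer matrix $M$ is the $2\times2$ matrix with $M\begin{pmatrix} A \\ B \end{pmatrix}=\begin{pmatrix} C \\ D \end{pmatrix}$ for all such solutions. The modified transfer matrix is $$T(k)=\begin{pmatrix} e^{\mathrm{i}kL} & 0 \\ 0 & e^{-\mathrm{i}kL} \end{pmatrix} M .$$ Eigenmode: the eigenmode $u_i$ associated with the eigenvalue $\lambda_i(k)$ is the solution of the wave equation in the infinite $L$-periodic chain whose coefficients $(A,B)$ immediately to the left of $D_1$ (i.e. $u_i=Ae^{\mathrm{i}kx}+Be^{-\mathrm{i}kx}$ there) form an eigenvector of $T(k)$ for $\lambda_i(k)$. The argument $\arg$ is defined modulo $2\pi$, so $\alpha(k)$ is defined modulo $2\pi/L$. *)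

(* Defs.v *)
From HB Require Import structures.
From mathcomp Require Import all_boot all_order all_algebra.
From mathcomp Require Import complex.
From mathcomp Require Import all_classical all_reals all_analysis.

Set Implicit Arguments.
Unset Strict Implicit.
Unset Printing Implicit Defensive.

Import Order.TTheory GRing.Theory Num.Theory.
Import numFieldNormedType.Exports.

Local Open Scope classical_set_scope.
Local Open Scope ring_scope.
Local Open Scope complex_scope.

Section Complex.
Variable R : realType.
Implicit Types (u : R -> R[i]) (x : R) (z l : R[i]).

Definition cexp z : R[i] :=
  (expR (complex.Re z))%:C * (cos (complex.Im z) +i* sin (complex.Im z)).

Definition cabs z : R := complex.Re `|z|.

(* The argument is multivalued: theta is one of the arguments of z. *)
Definition is_arg z (theta : R) : Prop := z = (cabs z)%:C * cexp ('i%C * theta%:C).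

(* R[i] carries no normed-module structure over R, so limits and derivatives
   of complex-valued functions of a real variable are taken componentwise. *)
Definition clim (F : set_system R) u l : Prop :=
  (complex.Re (u x) @[x --> F] --> complex.Re l) /\
  (complex.Im (u x) @[x --> F] --> complex.Im l).

Definition ccontinuous_at u x : Prop := clim (nbhs x) u (u x).

Definition cderivable u x : Prop :=
  derivable (fun t => complex.Re (u t)) x 1 /\
  derivable (fun t => complex.Im (u t)) x 1.

Definition cderive u x : R[i] :=
  derive1 (fun t => complex.Re (u t)) x +i*
  derive1 (fun t => complex.Im (u t)) x.

Definition diff_quot u x (h : R) : R[i] := (h^-1)%:C * (u (x + h) - u x).

Definition is_left_deriv u x l : Prop := clim 0^'- (diff_quot u x) l.
Definition is_right_deriv u x l : Prop := clim 0^'+ (diff_quot u x) l.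

End Complex.

Section Wave.
Variable R : realType.

Definition helmholtz_at (omega c : R) (u : R -> R[i]) (x : R) : Prop :=
  [/\ cderivable u x, cderivable (cderive u) x &
      cderive (cderive u) x + (omega ^+ 2 / c ^+ 2)%:C * u x = 0].

(* The wave equation for the resonators (a i, b i), i in I, with wave speed
   c i in the i-th one and v outside; I may be infinite.  Inside is to the
   right of a i and to the left of b i. *)
Definition wave_solution (I : Type) (a b c : I -> R) (v delta omega : R)
    (u : R -> R[i]) : Prop :=
  [/\ forall x, (forall i, x < a i \/ b i < x) -> helmholtz_at omega v u x,
      forall i x, a i < x < b i -> helmholtz_at omega (c i) u x,
      forall i, ccontinuous_at u (a i) /\ ccontinuous_at u (b i),
      forall i, exists din dout : R[i],
        [/\ is_right_deriv u (a i) din, is_left_deriv u (a i) dout &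
            din = delta%:C * dout] &
      forall i, exists din dout : R[i],
        [/\ is_left_deriv u (b i) din, is_right_deriv u (b i) dout &
            din = delta%:C * dout]].

Definition plane_waves (k : R) (A B : R[i]) (x : R) : R[i] :=
  A * cexp ('i%C * (k * x)%:C) + B * cexp (- ('i%C * (k * x)%:C)).

Definition cvec2 (A B : R[i]) : 'cV[R[i]]_2 :=
  \col_(i < 2) (if i == 0 then A else B).

(* The N.+1 resonators (xL j, xR j) are listed from left to right and lie in a
   cell with endpoints y and y + L.  The last condition keeps D_N apart from
   D_1 + L, so that the periodic repetition has an exterior immediately to the
   left of D_1; it only excludes resonators that fill the cell up to both of
   its endpoints. *)
Definition unit_cell (N : nat) (L y : R) (xL xR : 'I_N.+1 -> R) : Prop :=
  [/\ forall j, xL j < xR j,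
      forall i j : 'I_N.+1, j = i.+1 :> nat -> xR i < xL j,
      forall j, y <= xL j /\ xR j <= y + L &
      xR ord_max < xL ord0 + L].

Definition chain_solution (N : nat) (L : R) (xL xR c : 'I_N.+1 -> R)
    (v delta omega : R) (u : R -> R[i]) : Prop :=
  wave_solution (fun p : 'I_N.+1 * int => xL p.1 + p.2%:~R * L)
                (fun p : 'I_N.+1 * int => xR p.1 + p.2%:~R * L)
                (fun p : 'I_N.+1 * int => c p.1) v delta omega u.

Definition is_transfer_matrix (N : nat) (xL xR c : 'I_N.+1 -> R)
    (v delta omega : R) (M : 'M[R[i]]_2) : Prop :=
  forall (u : R -> R[i]) (A B C D : R[i]),
    wave_solution xL xR c v delta omega u ->
    (forall x, x < xL ord0 -> u x = plane_waves (omega / v) A B x) ->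
    (forall x, xR ord_max < x -> u x = plane_waves (omega / v) C D x) ->
    M *m cvec2 A B = cvec2 C D.

Definition modified_transfer_matrix (L k : R) (M : 'M[R[i]]_2) : 'M[R[i]]_2 :=
  diag_mx (\row_(i < 2) (if i == 0 then cexp ('i%C * (k * L)%:C)
                         else cexp (- ('i%C * (k * L)%:C)))) *m M.

(* Both eigenvalues, listed with algebraic multiplicity. *)
Definition are_eigenvalues (T : 'M[R[i]]_2) (lambda : 'I_2 -> R[i]) : Prop :=
  char_poly T = \prod_(i < 2) ('X - (lambda i)%:P).

(* The interval (xR ord_max - L, xL ord0) is the gap to the left of D_1. *)
Definition is_eigenmode (N : nat) (L : R) (xL xR c : 'I_N.+1 -> R)
    (v delta omega : R) (T : 'M[R[i]]_2) (lam : R[i]) (u : R -> R[i]) : Prop :=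
  chain_solution L xL xR c v delta omega u /\
  exists A B : R[i],
    [/\ cvec2 A B != 0, T *m cvec2 A B = lam *: cvec2 A B &
        forall x, xR ord_max - L < x < xL ord0 ->
          u x = plane_waves (omega / v) A B x].

End Wave.

(* Main.v *)
(** On each interval free of resonator endpoints a solution is a sinusoid, and
    the interface conditions carry its value and derivative across an endpoint
    in either direction.  Hence a solution of the chain that vanishes on one gap
    vanishes everywhere.  Cutting the eigenmode [u] off at its two gaps gives a
    solution for the isolated resonators, so the transfer matrix relates the two
    sets of coefficients, and the eigenvector equation says
    that [u (x + L) - lambda * u x] vanishes on the gap left of [D_1].
    Moreover [lambda != 0], as otherwise [u] itself would vanish. *)
Require Import Defs.
From HB Require Import structures.
From mathcomp Require Import all_boot all_order all_algebra.
From mathcomp Require Import complex.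
From mathcomp Require Import all_classical all_reals all_analysis.
From mathcomp Require Import zify ring lra.

Set Implicit Arguments.
Unset Strict Implicit.
Unset Printing Implicit Defensive.

Import Order.TTheory GRing.Theory Num.Theory.
Import numFieldNormedType.Exports.

Local Open Scope ring_scope.
Local Open Scope complex_scope.

(** * Real sinusoids and the one-dimensional Helmholtz equation *)

Section Sinusoid.
Variable R : realType.
Implicit Types (f : R -> R) (a b mu p q x : R).

Definition sinusoid mu a b x : R := a * cos (mu * x) + b * sin (mu * x).

#[local] Instance is_derive_sinusoid mu a b x :
  is_derive x 1 (sinusoid mu a b) (sinusoid mu (mu * b) (- (mu * a)) x).
Proof.
have dl : is_derive x 1 (fun t : R => mu * t) mu.
  by apply: is_derive_eq; rewrite [LHS]mulr1.
have dc := is_derive1_comp (is_derive_cos (mu * x)) dl.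
have ds := is_derive1_comp (is_derive_sin (mu * x)) dl.
have -> : sinusoid mu a b = a \*: (cos \o ( *%R mu)) + b \*: (sin \o ( *%R mu)).
  by apply/funext.
by apply: is_derive_eq; rewrite /sinusoid /GRing.scale /=; ring.
Qed.

(** The two hypotheses say that the rotation by the angle [mu * x] sends [(a, b)] to zero. The
    second quantity is the derivative of the sinusoid divided by [mu], so this is uniqueness for the
    Cauchy problem at [x]. *)
Lemma sinusoid_eq0 mu a b x :
  sinusoid mu a b x = 0 -> sinusoid mu b (- a) x = 0 -> a = 0 /\ b = 0.
Proof.
rewrite /sinusoid; move: (cos _) (sin _) (cos2Dsin2 (mu * x)) => c s cs h1 h2.
have -> : a = (c ^+ 2 + s ^+ 2) * a by rewrite cs mul1r.
have -> : b = (c ^+ 2 + s ^+ 2) * b by rewrite cs mul1r.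
split.
  transitivity (c * (a * c + b * s) - s * (b * c + - a * s)); first by ring.
  by rewrite h1 h2; ring.
transitivity (s * (a * c + b * s) + c * (b * c + - a * s)); first by ring.
by rewrite h1 h2; ring.
Qed.

Lemma sinusoidD mu a b x y :
  sinusoid mu a b (x + y) =
  sinusoid mu (sinusoid mu a b y) (sinusoid mu b (- a) y) x.
Proof. by rewrite /sinusoid mulrDr cosD sinD; ring. Qed.

Lemma derive0_constant f p q :
  (forall x, p < x < q -> is_derive x 1 f 0) ->
  forall x y, p < x < q -> p < y < q -> f x = f y.
Proof.
move=> df; suff H x y : p < x < q -> p < y < q -> x < y -> f x = f y.
  move=> x y hx hy; case: (ltgtP x y) => [xy|yx|-> //]; first exact: H.
  by apply/esym; exact: H.
move=> hx hy xy.
have [||c _ /eqP] := @MVT R f (fun=> 0) x y xy.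
- by move=> z; rewrite in_itv /= => hz; apply: df; lra.
- apply: derivable_within_continuous => z; rewrite in_itv /= => hz.
  by apply: ex_derive; apply: df; lra.
- by rewrite mul0r subr_eq0 => /eqP.
Qed.

Definition sinusoid_on mu p q f : Prop :=
  exists a b, forall x, p < x < q -> f x = sinusoid mu a b x.

Definition real_helmholtz mu f x : Prop :=
  [/\ derivable f x 1, derivable (derive1 f) x 1 &
      derive1 (derive1 f) x + mu ^+ 2 * f x = 0].

(* Variation of constants: [A / mu] and [B / mu] are the coefficients of the
   sinusoid that osculates [f], and they have zero derivative. *)
Lemma real_helmholtz_sinusoid mu p q f : mu != 0 ->
  (forall x, p < x < q -> real_helmholtz mu f x) -> sinusoid_on mu p q f.
Proof.
move=> mu0 H; have [pq|qp] := ltP p q; last first.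
  by exists 0, 0 => x hx; lra.
pose A := f * sinusoid mu mu 0 - derive1 f * sinusoid mu 0 1.
pose B := f * sinusoid mu 0 mu + derive1 f * sinusoid mu 1 0.
have dAB x : p < x < q -> is_derive x 1 A 0 /\ is_derive x 1 B 0.
  move=> /H[df ddf e].
  have df1 : is_derive x 1 f (derive1 f x).
    by rewrite derive1E; exact: derivableP.
  have ddf1 : is_derive x 1 (derive1 f) (- (mu ^+ 2 * f x)).
    move/eqP: e; rewrite addr_eq0 => /eqP <-.
    by rewrite [derive1 (derive1 f) x]derive1E; exact: derivableP.
  by split; apply: is_derive_eq; rewrite /sinusoid /GRing.scale /=; ring.
pose m := (p + q) / 2; have hm : p < m < q by rewrite /m; lra.
exists (A m / mu), (B m / mu) => x hx.
rewrite -(derive0_constant (fun x hx => (dAB x hx).1) hx hm).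
rewrite -(derive0_constant (fun x hx => (dAB x hx).2) hx hm).
have AE : A x = f x * sinusoid mu mu 0 x - derive1 f x * sinusoid mu 0 1 x.
  by [].
have BE : B x = f x * sinusoid mu 0 mu x + derive1 f x * sinusoid mu 1 0 x.
  by [].
rewrite AE BE /sinusoid.
move: (cos _) (sin _) (cos2Dsin2 (mu * x)) => c s cs.
by transitivity (f x * (c ^+ 2 + s ^+ 2)); [rewrite cs mulr1|field].
Qed.

End Sinusoid.

(** * Transmission conditions at one endpoint *)

Section Interface.
Variable R : realType.
Implicit Types (f g : R -> R) (a b mu p q x e d kappa s : R).
Implicit Types (F G : set_system R).

Local Open Scope classical_set_scope.

Definition slope_at f e h : R := h^-1 * (f (e + h) - f e).

Lemma slope_at_sinusoid F mu a b e : F --> (0 : R)^' ->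
  slope_at (sinusoid mu a b) e @ F --> sinusoid mu (mu * b) (- (mu * a)) e.
Proof.
move=> F0; apply: (cvg_trans (G := slope_at (sinusoid mu a b) e @ 0^')).
  exact: cvg_app.
have [dv vE] := is_derive_sinusoid mu a b e.
rewrite -vE; apply: cvg_trans dv; apply: near_eq_cvg; near=> h.
by rewrite /slope_at /= [h *: 1]mulr1 [e + h]addrC.
Unshelve. all: by end_near. Qed.

(** [F] stands for either side of 0. The sinusoid is smooth through [e], so uniqueness of limits
    identifies its value and slope there with those of [f]; continuity of [f] supplies the value at
    [e] itself. *)
Lemma one_sided_sinusoid F (FF : ProperFilter F) f e d mu a b :
  F --> (0 : R)^' -> f x @[x --> e] --> f e -> slope_at f e @ F --> d ->
  (\forall h \near F, f (e + h) = sinusoid mu a b (e + h)) ->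
  f e = sinusoid mu a b e /\ d = sinusoid mu (mu * b) (- (mu * a)) e.
Proof.
move=> F0 cf df near_f.
have Fe : e + h @[h --> F] --> e.
  rewrite -[X in _ --> X]addr0; apply: cvgD; first exact: cvg_cst.
  by apply: cvg_trans F0 _; exact: nbhs_dnbhs.
have fe : f e = sinusoid mu a b e.
  have cs : {for e, continuous (sinusoid mu a b)}.
    apply: differentiable_continuous; apply/derivable1_diffP.
    by have [] := is_derive_sinusoid mu a b e.
  have c1 : f (e + h) @[h --> F] --> f e by exact: cvg_comp Fe cf.
  have c2 : sinusoid mu a b (e + h) @[h --> F] --> sinusoid mu a b e.
    exact: cvg_comp Fe cs.
  apply: (cvg_unique _ c1) => //; apply: cvg_trans c2; apply: near_eq_cvg.
  by near do apply/esym.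
split=> //; apply: (cvg_unique _ df) => //.
apply: cvg_trans (slope_at_sinusoid (mu := mu) (a := a) (b := b) (e := e) F0).
apply: near_eq_cvg; near=> h; rewrite /slope_at fe; congr (_ * (_ - _)).
by apply/esym; near: h.
Unshelve. all: by end_near. Qed.

Lemma sinusoid0 mu x : sinusoid mu 0 0 x = 0.
Proof. by rewrite /sinusoid !mul0r addr0. Qed.

(** [F] and [G] are the two sides of [e], in either order. Vanishing on the [F] side gives zero
    value and slope at [e], the slope condition carries this to the [G] side, and zero Cauchy data
    kill the sinusoid there. *)
Lemma sinusoid_zero_across F G (FF : ProperFilter F) (FG : ProperFilter G)
    f e dF dG mu a b :
  F --> (0 : R)^' -> G --> (0 : R)^' -> mu != 0 -> f x @[x --> e] --> f e ->
  slope_at f e @ F --> dF -> slope_at f e @ G --> dG -> (dF = 0 -> dG = 0) ->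
  (\forall h \near F, f (e + h) = 0) ->
  (\forall h \near G, f (e + h) = sinusoid mu a b (e + h)) ->
  [/\ f e = 0, a = 0 & b = 0].
Proof.
move=> F0 G0 mu0 cf cF cG dFG zF sG.
have [|f0 d0] := @one_sided_sinusoid F FF f e dF mu 0 0 F0 cf cF.
  by apply: filterS zF => h ->; rewrite sinusoid0.
rewrite mulr0 oppr0 !sinusoid0 in f0 d0.
have [f1 d1] := one_sided_sinusoid FG G0 cf cG sG.
have [//||-> ->//] := @sinusoid_eq0 R mu a b e; first by rewrite -f1.
(* The slope [d1] is [mu] times the second quantity of [sinusoid_eq0]. *)
apply: (mulfI mu0); rewrite mulr0 -[RHS](dFG d0) d1 /sinusoid; ring.
Qed.

(** Phrased with left and right instead of inside and outside, so that one predicate serves both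
    ends of a resonator. *)
Definition interface kappa f e : Prop :=
  f x @[x --> e] --> f e /\
  exists dl dr, [/\ slope_at f e @ (0 : R)^'- --> dl,
    slope_at f e @ (0 : R)^'+ --> dr & dl = kappa * dr].

Lemma near_left_of p e : p < e -> \forall h \near (0 : R)^'-, p < e + h < e.
Proof.
move=> pe; near=> h; have h0 : h < 0 by near: h; exact: nbhs_left_lt.
have : p - e < h by near: h; apply: nbhs_left_gt; rewrite subr_lt0.
lra.
Unshelve. all: by end_near. Qed.

Lemma near_right_of e q : e < q -> \forall h \near (0 : R)^'+, e < e + h < q.
Proof.
move=> eq; near=> h; have h0 : 0 < h by near: h; exact: nbhs_right_gt.
have : h < q - e by near: h; apply: nbhs_right_lt; rewrite subr_gt0.
lra.
Unshelve. all: by end_near. Qed.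

Lemma at_left_dnbhs : (0 : R)^'- --> (0 : R)^'.
Proof. by apply: within_subset => r ?; rewrite lt_eqF. Qed.

Lemma at_right_dnbhs : (0 : R)^'+ --> (0 : R)^'.
Proof. by apply: within_subset => r ?; rewrite gt_eqF. Qed.

Lemma zero_across_right mu kappa p e q f :
  mu != 0 -> kappa != 0 -> p < e -> interface kappa f e ->
  sinusoid_on mu e q f -> (forall x, p < x < e -> f x = 0) ->
  forall x, p < x < q -> f x = 0.
Proof.
move=> mu0 k0 pe [cf [dl [dr [cl cr dlr]]]] [a [b fab]] z x hx.
have [eq|qe] := ltP e q; last by apply: z; lra.
have [|||fe a0 b0] := @sinusoid_zero_across _ _ _ _ f e dl dr mu a b
  at_left_dnbhs at_right_dnbhs mu0 cf cl cr.
(* Going right, the slope relation has to be solved for [dr], hence [kappa != 0]. *)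
- by move/eqP; rewrite dlr mulf_eq0 (negPf k0) => /eqP.
- by apply: filterS (near_left_of pe) => h; exact: z.
- by apply: filterS (near_right_of eq) => h; exact: fab.
case: (ltgtP x e) => [xe|ex|-> //]; first by apply: z; lra.
by rewrite fab ?a0 ?b0 ?sinusoid0 //; lra.
Qed.

Lemma zero_across_left mu kappa p e q f :
  mu != 0 -> e < q -> interface kappa f e ->
  sinusoid_on mu p e f -> (forall x, e < x < q -> f x = 0) ->
  forall x, p < x < q -> f x = 0.
Proof.
move=> mu0 eq [cf [dl [dr [cl cr dlr]]]] [a [b fab]] z x hx.
have [pe|ep] := ltP p e; last by apply: z; lra.
have [|||fe a0 b0] := @sinusoid_zero_across _ _ _ _ f e dr dl mu a b
  at_right_dnbhs at_left_dnbhs mu0 cf cr cl.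
- by rewrite dlr => ->; rewrite mulr0.
- by apply: filterS (near_right_of eq) => h; exact: z.
- by apply: filterS (near_left_of pe) => h; exact: fab.
case: (ltgtP x e) => [xe|ex|-> //]; last by apply: z; lra.
by rewrite fab ?a0 ?b0 ?sinusoid0 //; lra.
Qed.

Lemma sinusoid_onD mu p q f g s :
  sinusoid_on mu p q f -> sinusoid_on mu p q g ->
  sinusoid_on mu p q (fun x => f x + s * g x).
Proof.
move=> [a [b fab]] [a' [b' gab]]; exists (a + s * a'), (b + s * b') => x hx.
by rewrite fab // gab // /sinusoid; ring.
Qed.

Lemma sinusoid_on_shift mu p q f t : sinusoid_on mu (p + t) (q + t) f ->
  sinusoid_on mu p q (fun x => f (x + t)).
Proof.
move=> [a [b fab]]; exists (sinusoid mu a b t), (sinusoid mu b (- a) t) => x hx.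
by rewrite -sinusoidD fab //; lra.
Qed.

Lemma interfaceD kappa e f g s : interface kappa f e -> interface kappa g e ->
  interface kappa (fun x => f x + s * g x) e.
Proof.
move=> [cf [dl [dr [cl cr dlr]]]] [cf' [dl' [dr' [cl' cr' dlr']]]].
have slopeE : slope_at (fun x => f x + s * g x) e =
    (fun h => slope_at f e h + s * slope_at g e h).
  by apply/funext => h; rewrite /slope_at; ring.
split; first by apply: cvgD => //; apply: cvgMl_tmp.
exists (dl + s * dl'), (dr + s * dr'); rewrite slopeE; split.
- by apply: cvgD => //; apply: cvgMl_tmp.
- by apply: cvgD => //; apply: cvgMl_tmp.
- by rewrite dlr dlr'; ring.
Qed.

Lemma interface_shift kappa e f t : interface kappa f (e + t) ->
  interface kappa (fun x => f (x + t)) e.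
Proof.
move=> [cf [dl [dr [cl cr dlr]]]].
have slopeE : slope_at (fun x => f (x + t)) e = slope_at f (e + t).
  by apply/funext => h; rewrite /slope_at addrAC.
split; last by exists dl, dr; rewrite slopeE.
apply: (cvg_comp (fun x => x + t) f _ cf).
by apply: cvgD; [exact: cvg_id|exact: cvg_cst].
Qed.

End Interface.

(** * Real solutions on a chain of resonators *)

Section RealWave.
Variable R : realType.
Implicit Types (f g : R -> R) (v delta omega p q x t s : R).

Local Open Scope classical_set_scope.

Definition exterior (I : Type) (a b : I -> R) x : Prop :=
  forall i, x < a i \/ b i < x.

(* The left derivative is the outer one at [a i] and the inner one at [b i];
   hence the two different factors. *)
Definition real_wave (I : Type) (a b c : I -> R) v delta omega f : Prop :=
  [/\ forall p q, (forall x, p < x < q -> exterior a b x) ->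
        sinusoid_on (omega / v) p q f,
      forall i, sinusoid_on (omega / c i) (a i) (b i) f &
      forall i, interface delta^-1 f (a i) /\ interface delta f (b i)].

(** Applied twice, this yields the real and imaginary parts of [u (x + L) - lam * u x]. *)
Lemma real_waveD I (a b c : I -> R) v delta omega f g s :
  real_wave a b c v delta omega f -> real_wave a b c v delta omega g ->
  real_wave a b c v delta omega (fun x => f x + s * g x).
Proof.
move=> [f1 f2 f3] [g1 g2 g3]; split.
- by move=> p q pq; apply: sinusoid_onD; [exact: f1|exact: g1].
- by move=> i; exact: sinusoid_onD.
- by move=> i; have [? ?] := f3 i; have [? ?] := g3 i; split; exact: interfaceD.
Qed.

Section Chain.
Variables (N : nat) (xL xR : 'I_N.+1 -> R).
Hypothesis xLR : forall j, xL j < xR j.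
Hypothesis xRL : forall i j : 'I_N.+1, j = i.+1 :> nat -> xR i < xL j.

Lemma resonators_sorted (i j : 'I_N.+1) : (i < j)%N -> xR i < xL j.
Proof.
case: j => j; elim: j => // j IH jN /= ij.
have [ij'|ji] := ltnP i j; last by apply: xRL => /=; lia.
have jN' : (j < N.+1)%N by lia.
apply: (lt_trans (IH jN' ij')); apply: lt_trans (xLR _) _.
exact: xRL.
Qed.

Lemma first_le (j : 'I_N.+1) : xL ord0 <= xL j.
Proof.
have [j0|j0] := posnP j; first by rewrite (_ : ord0 = j) //; exact: val_inj.
by have := resonators_sorted (i := ord0) j0; have := xLR ord0; lra.
Qed.

Lemma le_last (j : 'I_N.+1) : xR j <= xR ord_max.
Proof.
have [jN|Nj] := ltnP j N.
  by have := resonators_sorted (j := ord_max) jN; have := xLR ord_max; lra.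
by rewrite (_ : j = ord_max) //; apply: val_inj => /=; have := ltn_ord j; lia.
Qed.

Lemma exterior_between (i j : 'I_N.+1) x : j = i.+1 :> nat ->
  xR i < x < xL j -> exterior xL xR x.
Proof.
move=> ij hx l; have [li|il] := ltnP l j.
  right; suff : xR l <= xR i by lra.
  have [li'|il'] := ltnP l i.
    by have := resonators_sorted li'; have := xLR i; lra.
  by rewrite (_ : l = i) //; apply: val_inj => /=; lia.
left; suff : xL j <= xL l by lra.
have [jl|lj] := ltnP j l.
  by have := resonators_sorted jl; have := xLR j; lra.
by rewrite (_ : l = j) //; apply: val_inj => /=; lia.
Qed.

Lemma exterior_outside x : x < xL ord0 \/ xR ord_max < x -> exterior xL xR x.
Proof.
move=> hx j; have := first_le j; have := le_last j.
by case: hx => ? ? ?; [left|right]; lra.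
Qed.

Variables (L v delta omega : R) (c : 'I_N.+1 -> R).

Let aL := fun p : 'I_N.+1 * int => xL p.1 + p.2%:~R * L.
Let aR := fun p : 'I_N.+1 * int => xR p.1 + p.2%:~R * L.
Let cc := fun p : 'I_N.+1 * int => c p.1.

(** Translation by [n] cells only reindexes the resonators, sending [(j, m)] to [(j, m + n)]. *)
Lemma real_wave_shift f (n : int) : real_wave aL aR cc v delta omega f ->
  real_wave aL aR cc v delta omega (fun x => f (x + n%:~R * L)).
Proof.
have sh (e : R) (m : int) : e + m%:~R * L + n%:~R * L = e + (m + n)%:~R * L.
  by rewrite intrD mulrDl addrA.
move=> [f1 f2 f3]; split.
- move=> p q pq; apply: sinusoid_on_shift; apply: f1 => x hx.
  have ex := pq (x - n%:~R * L) ltac:(lra).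
  move=> [j m]; have := ex (j, m - n); rewrite /aL /aR /= intrB mulrBl.
  by case=> ?; [left|right]; lra.
- move=> [j m]; apply: sinusoid_on_shift; rewrite /aL /aR /= !sh.
  exact: f2 (j, m + n).
- move=> [j m]; have [fL fR] := f3 (j, m + n).
  by split; apply: interface_shift; rewrite /aL /aR /= sh.
Qed.

Hypotheses (L_gt0 : 0 < L) (gap : xR ord_max < xL ord0 + L).

(** Between these bounds only the copies with [n = 0] matter: those with [n < 0] end no later than
    [xR ord_max - L], and those with [n > 0] start no earlier than [xL ord0 + L]. *)
Lemma exterior_chain x : xR ord_max - L < x < xL ord0 + L ->
  exterior xL xR x -> exterior aL aR x.
Proof.
move=> hx ex [j n]; rewrite /aL /aR /=.
have := first_le j; have := le_last j.
case: (ltgtP n 0) => [n0|n0|->]; last by rewrite mul0r !addr0.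
  have : n%:~R * L <= -1 * L.
    by rewrite ler_pM2r // -[-1]/((-1)%:~R) ler_int; lia.
  by move=> ? ? ?; right; lra.
have : 1 * L <= n%:~R * L by rewrite ler_pM2r // -[1]/(1%:~R) ler_int; lia.
by move=> ? ? ?; left; lra.
Qed.

Hypotheses (v_gt0 : 0 < v) (c_gt0 : forall j, 0 < c j).
Hypotheses (delta_gt0 : 0 < delta) (omega_gt0 : 0 < omega).

(** * Unique continuation through one cell *)

Section Period.
Variable f : R -> R.
Hypothesis wave : real_wave aL aR cc v delta omega f.

Lemma gap_sinusoid p q : xR ord_max - L <= p -> q <= xL ord0 + L ->
  (forall x, p < x < q -> exterior xL xR x) -> sinusoid_on (omega / v) p q f.
Proof.
have [f1 _ _] := wave; move=> hp hq ex; apply: f1 => x hx.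
by apply: exterior_chain; [lra|exact: ex].
Qed.

Lemma resonator_sinusoid j : sinusoid_on (omega / c j) (xL j) (xR j) f.
Proof.
have [_ f2 _] := wave; have := f2 (j, 0).
by rewrite /aL /aR /= mul0r !addr0.
Qed.

Lemma resonator_interface j :
  interface delta^-1 f (xL j) /\ interface delta f (xR j).
Proof.
have [_ _ f3] := wave; have := f3 (j, 0).
by rewrite /aL /aR /= mul0r !addr0.
Qed.

Let mu_neq0 w : 0 < w -> omega / w != 0.
Proof. by move=> w0; rewrite gt_eqF // divr_gt0. Qed.

Let delta_neq0 : delta != 0. Proof. by rewrite gt_eqF. Qed.

(** Two crossings: into the resonator at [xL j] with factor [delta^-1], then out of it at [xR j]
    with factor [delta]. *)
Lemma zero_past_resonator p q j : p < xL j ->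
  sinusoid_on (omega / v) (xR j) q f -> (forall x, p < x < xL j -> f x = 0) ->
  forall x, p < x < q -> f x = 0.
Proof.
move=> pj fq z; have [iL iR] := resonator_interface j.
have zj : forall x, p < x < xR j -> f x = 0.
  exact: zero_across_right (mu_neq0 (c_gt0 j)) (invr_neq0 delta_neq0) pj iL
    (resonator_sinusoid j) z.
apply: zero_across_right (mu_neq0 v_gt0) delta_neq0 _ iR fq zj.
by have := xLR j; lra.
Qed.

Lemma zero_before_resonator p q j : xR j < q ->
  sinusoid_on (omega / v) p (xL j) f -> (forall x, xR j < x < q -> f x = 0) ->
  forall x, p < x < q -> f x = 0.
Proof.
move=> jq fp z; have [iL iR] := resonator_interface j.
have zj : forall x, xL j < x < q -> f x = 0.
  exact: zero_across_left (mu_neq0 (c_gt0 j)) jq iR (resonator_sinusoid j) z.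
apply: zero_across_left (mu_neq0 v_gt0) _ iL fp zj.
by have := xLR j; lra.
Qed.

Lemma zero_past_cell : (forall x, xR ord_max - L < x < xL ord0 -> f x = 0) ->
  forall x, xR ord_max - L < x < xL ord0 + L -> f x = 0.
Proof.
move=> z0; have hgap := gap; have L0 := L_gt0.
(* The zero set grows rightwards, one resonator together with the gap after it per induction step.
   The last resonator has no successor and is crossed separately below. *)
have z (n : nat) (j : 'I_N.+1) : j = n :> nat ->
    forall x, xR ord_max - L < x < xL j -> f x = 0.
  elim: n j => [|n IH] j jn.
    by rewrite (_ : j = ord0) //; exact: val_inj.
  have [i iE] : exists i : 'I_N.+1, i = n :> nat.
    by exists (inord n); rewrite inordK //; have := ltn_ord j; lia.
  have ij : j = i.+1 :> nat by rewrite iE.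
  have hL := first_le i; have hR := xLR i.
  have hL' := le_last j; have hR' := xLR j.
  apply: zero_past_resonator (IH i iE); first by lra.
  apply: gap_sinusoid; [lra|lra|move=> x hx].
  exact: exterior_between ij hx.
have hL := first_le ord_max; have hR := xLR ord_max.
apply: zero_past_resonator (z N ord_max erefl); first by lra.
apply: gap_sinusoid => [||x hx]; [lra|lra|].
by apply: exterior_outside; right; lra.
Qed.

Lemma zero_before_cell : (forall x, xR ord_max < x < xL ord0 + L -> f x = 0) ->
  forall x, xR ord_max - L < x < xL ord0 + L -> f x = 0.
Proof.
move=> zN; have hgap := gap; have L0 := L_gt0.
(* Mirror image: the induction is on [i], the number of resonators to the right of [j]. *)
have z (i : nat) (j : 'I_N.+1) : (i + j = N)%N ->
    forall x, xR j < x < xL ord0 + L -> f x = 0.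
  elim: i j => [|i IH] j ijN.
    by rewrite (_ : j = ord_max) //; exact: val_inj.
  have [k kE] : exists k : 'I_N.+1, k = j.+1 :> nat.
    by exists (inord j.+1); rewrite inordK //; lia.
  have hL := first_le j; have hR := xLR j.
  have hL' := le_last k; have hR' := xLR k; have jk := xRL kE.
  apply: zero_before_resonator (IH k _); [lra| |lia].
  apply: gap_sinusoid; [lra|lra|move=> x hx].
  exact: exterior_between kE hx.
have hL := le_last ord0; have hR := xLR ord0.
apply: zero_before_resonator (z N ord0 (addn0 _)); first by lra.
apply: gap_sinusoid => [||x hx]; [lra|lra|].
by apply: exterior_outside; left; lra.
Qed.

End Period.

(** The zero passes from gap to gap in both directions, and each cell then inherits it from the gap
    on its left. *)
Lemma zero_on_gap_everywhere f : real_wave aL aR cc v delta omega f ->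
  (forall x, xR ord_max - L < x < xL ord0 -> f x = 0) -> forall x, f x = 0.
Proof.
move=> wave z0; have hgap := gap; have L0 := L_gt0.
have step g : real_wave aL aR cc v delta omega g ->
    (forall x, xR ord_max - L < x < xL ord0 -> g x = 0) ->
    forall x, xR ord_max - L < x < xL ord0 -> g (x + L) = 0.
  by move=> wg zg x hx; apply: (zero_past_cell wg zg); lra.
have zn (n : nat) x : xR ord_max - L < x < xL ord0 ->
    f (x + n%:~R * L) = 0 /\ f (x + (- n%:Z)%:~R * L) = 0.
  elim: n x => [|n IH] x hx; first by rewrite oppr0 mul0r addr0 z0.
  split.
    rewrite [x + _](_ : _ = x + L + n%:~R * L); last first.
      by rewrite intS intrD; ring.
    exact: (step _ (real_wave_shift n wave) (fun x hx => (IH x hx).1)).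
  (* After this shift the gap on the right of the cell is the left gap moved by [- n] periods, where
     the induction hypothesis applies. *)
  have := zero_before_cell (real_wave_shift (- n.+1%:Z) wave).
  apply; last by lra.
  move=> t ht; rewrite (_ : _ + _ = (t - L) + (- n%:Z)%:~R * L); last first.
    by rewrite intS opprD intrD; ring.
  by have [] := IH (t - L) ltac:(lra).
(* This [n] places [x - n%:~R * L] between [xL ord0] (included) and [xL ord0 + L], inside the range
   of [zero_past_cell]. *)
move=> x; pose n := Num.floor ((x - xL ord0) / L).
have zn' t : xR ord_max - L < t < xL ord0 -> f (t + n%:~R * L) = 0.
  move=> /zn H; case: n => m; first by have [] := H m.
  by rewrite NegzE; have [] := H m.+1.
have := zero_past_cell (real_wave_shift n wave) zn' (x := x - n%:~R * L).
rewrite subrK; apply.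
have := real_floor_itv (num_real ((x - xL ord0) / L)).
rewrite -/n ler_pdivlMr // ltr_pdivrMr // intrD mulrDl mul1r.
lra.
Qed.

End Chain.
End RealWave.

(** * Real and imaginary parts, locality, and plane waves *)

Section Components.
Variable R : realType.
Implicit Types (u w : R -> R[i]) (v delta omega k x r : R) (z A B : R[i]).

Local Open Scope classical_set_scope.

Local Notation re u := (fun x => complex.Re (u x)).
Local Notation im u := (fun x => complex.Im (u x)).

Lemma Re_realM r z : complex.Re (r%:C * z) = r * complex.Re z.
Proof. by case: z => a b /=; rewrite mul0r subr0. Qed.

Lemma Im_realM r z : complex.Im (r%:C * z) = r * complex.Im z.
Proof. by case: z => a b /=; rewrite mul0r addr0. Qed.

Lemma ReD (z w : R[i]) : complex.Re (z + w) = complex.Re z + complex.Re w.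
Proof. by case: z => a b; case: w. Qed.

Lemma ImD (z w : R[i]) : complex.Im (z + w) = complex.Im z + complex.Im w.
Proof. by case: z => a b; case: w. Qed.

Lemma complexP (z w : R[i]) :
  complex.Re z = complex.Re w -> complex.Im z = complex.Im w -> z = w.
Proof. by case: z => a b; case: w => c d /= -> ->. Qed.

Lemma helmholtz_components omega v u x : helmholtz_at omega v u x <->
  real_helmholtz (omega / v) (re u) x /\ real_helmholtz (omega / v) (im u) x.
Proof.
rewrite /real_helmholtz expr_div_n.
set r := omega ^+ 2 / v ^+ 2; set d2 := cderive (cderive u) x.
have eRe : derive1 (derive1 (re u)) x + r * re u x =
    complex.Re (d2 + r%:C * u x).
  by rewrite (ReD d2) (Re_realM r).
have eIm : derive1 (derive1 (im u)) x + r * im u x =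
    complex.Im (d2 + r%:C * u x).
  by rewrite (ImD d2) (Im_realM r).
split=> [[[d1 d1'] [dd1 dd1'] e]|[[d1 dd1 e1] [d1' dd1' e2]]].
  split; split; [exact: d1|exact: dd1| |exact: d1'|exact: dd1'|].
    exact: etrans eRe (congr1 _ e).
  exact: etrans eIm (congr1 _ e).
split; [exact: conj d1 d1'|exact: conj dd1 dd1'|].
apply: (@complexP (d2 + r%:C * u x) 0).
  exact: etrans (esym eRe) e1.
exact: etrans (esym eIm) e2.
Qed.

Lemma slope_at_Re u x : slope_at (re u) x = re (diff_quot u x).
Proof.
apply/funext => h; rewrite /slope_at /diff_quot Re_realM.
by case: (u (x + h)) (u x) => a b [].
Qed.

Lemma slope_at_Im u x : slope_at (im u) x = im (diff_quot u x).
Proof.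
apply/funext => h; rewrite /slope_at /diff_quot Im_realM.
by case: (u (x + h)) (u x) => a b [].
Qed.

(** All conditions are linear with real coefficients, so they split into components; on each
    interval the equation is then replaced by its explicit solutions. *)
Lemma wave_solution_components (I : Type) (a b c : I -> R) v delta omega u :
  0 < v -> (forall i, 0 < c i) -> 0 < delta -> 0 < omega ->
  wave_solution a b c v delta omega u ->
  real_wave a b c v delta omega (re u) /\ real_wave a b c v delta omega (im u).
Proof.
move=> v0 c0 d0 o0 [ext int cont trL trR].
have mu0 t : 0 < t -> omega / t != 0 by move=> t0; rewrite gt_eqF // divr_gt0.
have dn0 : delta != 0 by rewrite gt_eqF.
split; split=> [p q pq|i|i].
- apply: real_helmholtz_sinusoid (mu0 v v0) _ => x hx.
  by have /helmholtz_components[] := ext x (pq x hx).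
- apply: real_helmholtz_sinusoid (mu0 _ (c0 i)) _ => x hx.
  by have /helmholtz_components[] := int i x hx.
- have [[ca _] [cb _]] := cont i.
  have [din [dout [[r1 _] [l1 _] e1]]] := trL i.
  have [din' [dout' [[l2 _] [r2 _] e2]]] := trR i.
  split; split=> //; rewrite slope_at_Re.
    (* At [a i] the outside is on the left, so [din = delta * dout] is read backwards. *)
    exists (complex.Re dout), (complex.Re din); split=> //.
    by rewrite e1 Re_realM mulKf.
  exists (complex.Re din'), (complex.Re dout'); split=> //.
  by rewrite e2 Re_realM.
- apply: real_helmholtz_sinusoid (mu0 v v0) _ => x hx.
  by have /helmholtz_components[] := ext x (pq x hx).
- apply: real_helmholtz_sinusoid (mu0 _ (c0 i)) _ => x hx.
  by have /helmholtz_components[] := int i x hx.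
- have [[_ ca] [_ cb]] := cont i.
  have [din [dout [[_ r1] [_ l1] e1]]] := trL i.
  have [din' [dout' [[_ l2] [_ r2] e2]]] := trR i.
  split; split=> //; rewrite slope_at_Im.
    exists (complex.Im dout), (complex.Im din); split=> //.
    by rewrite e1 Im_realM mulKf.
  exists (complex.Im din'), (complex.Im dout'); split=> //.
  by rewrite e2 Im_realM.
Qed.

Lemma real_helmholtz_near mu (f g : R -> R) x :
  (\forall t \near x, f t = g t) ->
  real_helmholtz mu f x -> real_helmholtz mu g x.
Proof.
move=> fg [d dd e].
(* The second derivative at [x] depends on first derivatives near [x], so agreement is needed near
   every point close to [x]. *)
have dfg : \forall t \near x, derive1 f t = derive1 g t.
  apply: filterS (near_join fg) => t ftg.
  by rewrite !derive1E; exact: near_eq_derive.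
split; [exact: near_eq_derivable d|exact: near_eq_derivable dd|].
by rewrite -(nbhs_singleton fg) derive1E -(near_eq_derive _ dfg) -derive1E.
Qed.

Lemma sinusoid_helmholtz mu a b x : real_helmholtz mu (sinusoid mu a b) x.
Proof.
have d m a' b' : derive1 (sinusoid m a' b') = sinusoid m (m * b') (- (m * a')).
  apply/funext => t; rewrite derive1E.
  by have [_ ->] := is_derive_sinusoid m a' b' t.
split; rewrite ?d; [by have [] := is_derive_sinusoid mu a b x| |].
  by have [] := is_derive_sinusoid mu (mu * b) (- (mu * a)) x.
by rewrite /sinusoid; ring.
Qed.

Lemma helmholtz_near omega v u w x : (\forall t \near x, u t = w t) ->
  helmholtz_at omega v u x -> helmholtz_at omega v w x.
Proof.
move=> uw /helmholtz_components[h1 h2]; apply/helmholtz_components; split.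
  by apply: real_helmholtz_near h1; apply: filterS uw => t ->.
by apply: real_helmholtz_near h2; apply: filterS uw => t ->.
Qed.

Lemma clim_near (F : set_system R) (FF : Filter F) u w z :
  (\forall t \near F, u t = w t) -> clim F u z -> clim F w z.
Proof.
move=> uw [c1 c2]; split.
  by apply: cvg_trans c1; apply: near_eq_cvg; apply: filterS uw => t ->.
by apply: cvg_trans c2; apply: near_eq_cvg; apply: filterS uw => t ->.
Qed.

Lemma diff_quot_near (F : set_system R) (FF : Filter F) u w x z :
  F --> (0 : R) -> (\forall t \near x, u t = w t) ->
  clim F (diff_quot u x) z -> clim F (diff_quot w x) z.
Proof.
move=> F0 uw; apply: (clim_near FF).
have xh : x + h @[h --> F] --> x.
  by rewrite -[X in _ --> X]addr0; apply: cvgD => //; exact: cvg_cst.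
have uwh : \forall h \near F, u (x + h) = w (x + h) := xh _ uw.
apply: filterS uwh => h e.
by rewrite /diff_quot e (nbhs_singleton uw).
Qed.

Lemma plane_wavesE k A B x : plane_waves k A B x =
  sinusoid k (complex.Re A + complex.Re B) (complex.Im B - complex.Im A) x +i*
  sinusoid k (complex.Im A + complex.Im B) (complex.Re A - complex.Re B) x.
Proof.
rewrite /plane_waves /cexp /sinusoid; case: A => a a'; case: B => b b'.
apply: complexP => /=;
  rewrite ?(mul0r, mulr0, mul1r, subr0, sub0r, addr0, add0r) ?oppr0;
  rewrite ?expR0 ?cosN ?sinN; ring.
Qed.

Lemma plane_waves_of_sinusoids k (a b a' b' : R) : exists A B, forall x,
  plane_waves k A B x = sinusoid k a b x +i* sinusoid k a' b' x.
Proof.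
(* The witnesses invert the linear system for the four coefficients in [plane_wavesE]. *)
exists (((a + b') / 2) +i* ((a' - b) / 2)), (((a - b') / 2) +i* ((a' + b) / 2)).
by move=> x; rewrite plane_wavesE /=; congr (_ +i* _); congr sinusoid; field.
Qed.

Lemma plane_waves_helmholtz omega v A B x :
  helmholtz_at omega v (plane_waves (omega / v) A B) x.
Proof.
have -> : plane_waves (omega / v) A B = _ := funext (plane_wavesE _ A B).
by apply/helmholtz_components; split; exact: sinusoid_helmholtz.
Qed.

Lemma cexpD (z w : R[i]) : cexp (z + w) = cexp z * cexp w.
Proof.
case: z => a b; case: w => a' b'; rewrite /cexp /= expRD cosD sinD.
by apply: complexP => /=; ring.
Qed.

(** For [y = L] the new coefficients are those produced by the diagonal factor of
    [modified_transfer_matrix]. *)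
Lemma plane_wavesD k A B x y : plane_waves k A B (x + y) =
  plane_waves k (cexp ('i%C * (k * y)%:C) * A)
    (cexp (- ('i%C * (k * y)%:C)) * B) x.
Proof.
rewrite /plane_waves mulrDr rmorphD mulrDr opprD !cexpD; ring.
Qed.

Lemma plane_wavesZ k z A B x :
  plane_waves k (z * A) (z * B) x = z * plane_waves k A B x.
Proof. by rewrite /plane_waves; ring. Qed.

Lemma plane_waves_eq0 k A B p q : k != 0 -> p < q ->
  (forall x, p < x < q -> plane_waves k A B x = 0) -> A = 0 /\ B = 0.
Proof.
move=> k0 pq z.
pose m := (p + q) / 2.
have zero a b : (forall x, p < x < q -> sinusoid k a b x = 0) -> a = 0 /\ b = 0.
  move=> zs; have hm : p < m < q by rewrite /m; lra.
  apply: (@sinusoid_eq0 R k a b m); first exact: zs.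
  apply: (mulfI k0); rewrite mulr0.
  (* The second Cauchy datum at [m] comes from the derivative, which is zero because the sinusoid
     vanishes around [m]. *)
  have <- : derive1 (sinusoid k a b) m = 0.
    rewrite derive1E (@near_eq_derive _ _ _ _ (cst 0)) ?derive_cst //.
    near=> t; apply: zs; apply/andP; split; near: t.
      by apply: lt_nbhsr; case/andP: hm.
    by apply: lt_nbhsl; case/andP: hm.
  rewrite derive1E; have [_ ->] := is_derive_sinusoid k a b m.
  by rewrite /sinusoid; ring.
have [|r1 i1] := zero (complex.Re A + complex.Re B)
  (complex.Im B - complex.Im A).
  by move=> x /z; rewrite plane_wavesE => -[].
have [|i2 r2] := zero (complex.Im A + complex.Im B)
  (complex.Re A - complex.Re B).
  by move=> x /z; rewrite plane_wavesE => -[].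
by split; apply: complexP => /=; lra.
Unshelve. all: by end_near. Qed.

End Components.

(** * From the transfer matrix to quasiperiodicity *)

Section Transfer.
Variables (R : realType) (N : nat) (L v delta omega : R).
Variables (xL xR c : 'I_N.+1 -> R).
Hypotheses (L_gt0 : 0 < L) (v_gt0 : 0 < v) (c_gt0 : forall j, 0 < c j).
Hypotheses (delta_gt0 : 0 < delta) (omega_gt0 : 0 < omega).
Hypothesis xLR : forall j, xL j < xR j.
Hypothesis xRL : forall i j : 'I_N.+1, j = i.+1 :> nat -> xR i < xL j.
Hypothesis gap : xR ord_max < xL ord0 + L.

Local Open Scope classical_set_scope.

Local Notation k := (omega / v).
Local Notation chain := (chain_solution L xL xR c v delta omega).

Lemma chain_components u : chain u ->
  real_wave (fun p : 'I_N.+1 * int => xL p.1 + p.2%:~R * L)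
    (fun p => xR p.1 + p.2%:~R * L) (fun p => c p.1) v delta omega
    (fun x => complex.Re (u x)) /\
  real_wave (fun p : 'I_N.+1 * int => xL p.1 + p.2%:~R * L)
    (fun p => xR p.1 + p.2%:~R * L) (fun p => c p.1) v delta omega
    (fun x => complex.Im (u x)).
Proof. by apply: wave_solution_components => // -[j n]; exact: c_gt0. Qed.

Lemma chain_right_gap u : chain u ->
  exists C D, forall x, xR ord_max < x < xL ord0 + L ->
    u x = plane_waves k C D x.
Proof.
move=> /chain_components[wRe wIm].
have ex x : xR ord_max < x < xL ord0 + L -> exterior xL xR x.
  by move=> hx; apply: (exterior_outside xLR xRL); right; case/andP: hx.
have lo : xR ord_max - L <= xR ord_max by have := L_gt0; lra.
have [a [b ab]] := gap_sinusoid xLR xRL L_gt0 gap wRe lo (lexx _) ex.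
have [a' [b' ab']] := gap_sinusoid xLR xRL L_gt0 gap wIm lo (lexx _) ex.
have [C [D CD]] := plane_waves_of_sinusoids k a b a' b'.
exists C, D => x hx; rewrite CD -(ab x hx) -(ab' x hx).
exact: complexP.
Qed.

(* Outside the resonators [u] is continued by the plane waves that it equals
   in the two adjacent gaps; the result solves the problem for the isolated
   resonators. *)
Lemma isolated_wave u A B C D : chain u ->
  (forall x, xR ord_max - L < x < xL ord0 -> u x = plane_waves k A B x) ->
  (forall x, xR ord_max < x < xL ord0 + L -> u x = plane_waves k C D x) ->
  exists w, [/\ wave_solution xL xR c v delta omega w,
    forall x, x < xL ord0 -> w x = plane_waves k A B x &
    forall x, xR ord_max < x -> w x = plane_waves k C D x].
Proof.
move=> [ext int cont trL trR] uAB uCD.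
have hgap := gap; have L0 := L_gt0.
have LR : xL ord0 < xR ord_max.
  by have := first_le xLR xRL ord_max; have := xLR ord_max; lra.
pose w x := if x < xL ord0 then plane_waves k A B x
  else if xR ord_max < x then plane_waves k C D x else u x.
have wAB x : x < xL ord0 -> w x = plane_waves k A B x by rewrite /w => ->.
have wCD x : xR ord_max < x -> w x = plane_waves k C D x.
  by rewrite /w => hx; rewrite hx ltNge (ltW (lt_trans LR hx)).
(* This open interval contains all endpoints of the resonators in the cell, so every local condition
   there passes from [u] to [w]. *)
have wu x : xR ord_max - L < x < xL ord0 + L -> u x = w x.
  rewrite /w => hx; case: ltP => h1; first by apply: uAB; lra.
  by case: ltP => h2 //; apply: uCD; lra.
have near_wu x : xR ord_max - L < x < xL ord0 + L ->
    \forall t \near x, u t = w t.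
  case/andP=> hx1 hx2; near=> t; apply: wu; apply/andP; split; near: t.
    exact: lt_nbhsr.
  exact: lt_nbhsl.
have cellL j : xR ord_max - L < xL j < xL ord0 + L.
  by have := first_le xLR xRL j; have := le_last xLR xRL j; have := xLR j; lra.
have cellR j : xR ord_max - L < xR j < xL ord0 + L.
  by have := first_le xLR xRL j; have := le_last xLR xRL j; have := xLR j; lra.
have l0 : (0 : R)^'- --> (0 : R) by exact: cvg_within.
have r0 : (0 : R)^'+ --> (0 : R) by exact: cvg_within.
exists w; split=> //; split.
- move=> x ex; have [xl|lx] := ltP x (xL ord0).
    apply: helmholtz_near (plane_waves_helmholtz omega v A B x).
    near=> t; apply/esym/wAB; near: t; exact: lt_nbhsl.
  have [rx|xr] := ltP (xR ord_max) x.
    apply: helmholtz_near (plane_waves_helmholtz omega v C D x).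
    near=> t; apply/esym/wCD; near: t; exact: lt_nbhsr.
  have hx : xR ord_max - L < x < xL ord0 + L by lra.
  by apply: helmholtz_near (near_wu x hx) _; apply: ext; exact: exterior_chain.
- move=> j x hx; have hx' : xR ord_max - L < x < xL ord0 + L.
    by have := cellL j; have := cellR j; lra.
  apply: helmholtz_near (near_wu x hx') _; apply: (int (j, 0)).
  by rewrite /= mul0r !addr0.
- move=> j; have := cont (j, 0); rewrite /= mul0r !addr0 => -[cL cR].
  rewrite /ccontinuous_at -!wu //.
  by split; [apply: clim_near (near_wu _ (cellL j)) cL|
             apply: clim_near (near_wu _ (cellR j)) cR].
- move=> j; have := trL (j, 0); rewrite /= mul0r !addr0.
  move=> [din [dout [r l e]]].
  exists din, dout; split=> //.
    by apply: diff_quot_near r0 (near_wu _ (cellL j)) r.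
  by apply: diff_quot_near l0 (near_wu _ (cellL j)) l.
- move=> j; have := trR (j, 0); rewrite /= mul0r !addr0.
  move=> [din [dout [l r e]]].
  exists din, dout; split=> //.
    by apply: diff_quot_near l0 (near_wu _ (cellR j)) l.
  by apply: diff_quot_near r0 (near_wu _ (cellR j)) r.
Unshelve. all: by end_near. Qed.

(** The defect [u (x + L) - lam * u x] again solves the chain problem, since the chain is periodic.
    Unique continuation applies to its two components. *)
Lemma quasiperiodic_of_gap u lam : chain u ->
  (forall x, xR ord_max - L < x < xL ord0 -> u (x + L) = lam * u x) ->
  forall x, u (x + L) = lam * u x.
Proof.
move=> /chain_components[wRe wIm] ugap x.
have wRe1 := real_wave_shift 1 wRe.
have wIm1 := real_wave_shift 1 wIm.
have zero := zero_on_gap_everywhere xLR xRL L_gt0 gap v_gt0 c_gt0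
  delta_gt0 omega_gt0.
have ReM (y z : R[i]) : complex.Re (y * z) =
    complex.Re y * complex.Re z - complex.Im y * complex.Im z.
  by case: y; case: z.
have ImM (y z : R[i]) : complex.Im (y * z) =
    complex.Im y * complex.Re z + complex.Re y * complex.Im z.
  by case: y => a b; case: z => a' b' /=; rewrite addrC.
have eRe : complex.Re (u (x + 1%:~R * L)) +
    - complex.Re lam * complex.Re (u x) + complex.Im lam * complex.Im (u x) = 0.
  apply: (zero _ (real_waveD _ (real_waveD _ wRe1 wRe) wIm)) => t ht.
  by rewrite mul1r ugap // ReM; ring.
have eIm : complex.Im (u (x + 1%:~R * L)) +
    - complex.Re lam * complex.Im (u x) + - complex.Im lam * complex.Re (u x) = 0.
  apply: (zero _ (real_waveD _ (real_waveD _ wIm1 wIm) wRe)) => t ht.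
  by rewrite mul1r ugap // ImM; ring.
rewrite mul1r in eRe eIm.
by apply: complexP; rewrite ?ReM ?ImM; lra.
Qed.

Lemma eigenmode_quasiperiodic M u lam :
  is_transfer_matrix xL xR c v delta omega M ->
  is_eigenmode L xL xR c v delta omega (modified_transfer_matrix L k M) lam u ->
  lam != 0 /\ forall x, u (x + L) = lam * u x.
Proof.
move=> transfer [wave [A [B [AB0 eig uAB]]]].
have [C [D uCD]] := chain_right_gap wave.
have [w [ww wAB wCD]] := isolated_wave wave uAB uCD.
move: eig; rewrite /modified_transfer_matrix -mulmxA.
rewrite (transfer w A B C D) // => eig.
(* The two rows of the eigenvector equation, with [M] applied to [(A, B)] replaced by [(C, D)]. *)
have eC : cexp ('i%C * (k * L)%:C) * C = lam * A.
  move/matrixP: eig => /(_ 0 0).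
  by rewrite mul_diag_mx !mxE /=.
have eD : cexp (- ('i%C * (k * L)%:C)) * D = lam * B.
  move/matrixP: eig => /(_ 1 0).
  by rewrite mul_diag_mx !mxE /=.
have qp : forall x, u (x + L) = lam * u x.
  apply: quasiperiodic_of_gap => // x hx.
  rewrite uCD; last by have := gap; have := L_gt0; lra.
  by rewrite plane_wavesD eC eD plane_wavesZ uAB.
(* If [lam = 0], then [u x = lam * u (x - L) = 0] on the left gap, which forces [A = B = 0]. *)
split=> //; apply: contraNneq AB0 => lam0.
have k0 : k != 0 by rewrite gt_eqF // divr_gt0.
have hg : xR ord_max - L < xL ord0 by have := gap; lra.
have [|-> ->] := plane_waves_eq0 (A := A) (B := B) k0 hg.
  by move=> x hx; rewrite -uAB // -[x](subrK L) qp lam0 mul0r.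
by apply/eqP/matrixP => i j; rewrite !mxE; case: ifP.
Qed.

End Transfer.

(** * The eigenvalue as an exponential *)

Lemma cexp_arg_log (R : realType) (L theta : R) (lam : R[i]) :
  0 < L -> lam != 0 -> is_arg lam theta ->
  cexp ('i%C * ((L^-1 * theta) +i* - (L^-1 * ln (cabs lam))) * L%:C) = lam.
Proof.
move=> L0 lam0 arg.
have -> : 'i%C * ((L^-1 * theta) +i* - (L^-1 * ln (cabs lam))) * L%:C =
    ln (cabs lam) +i* theta.
  by apply: complexP => /=; field; rewrite gt_eqF.
rewrite [RHS]arg /cexp /= lnK.
  by rewrite !(mul0r, mulr0, mul1r, oppr0, addr0, add0r) expR0 mul1r.
(* [expR] undoes [ln] only at positive arguments, which is where [lam != 0] enters. *)
have := normr_gt0 lam; rewrite lam0 posrE /cabs.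
by case: (`|lam|) => a b; rewrite ltcE /= => /andP[].
Qed.

Theorem theorem2p11 (R : realType) (N : nat) (L y v delta omega k : R)
    (xL xR c : 'I_N.+1 -> R) (M : 'M[R[i]]_2) (lambda : 'I_2 -> R[i])
    (L_gt0 : 0 < L) (cell : unit_cell L y xL xR)
    (v_gt0 : 0 < v) (c_gt0 : forall j, 0 < c j) (delta_gt0 : 0 < delta)
    (omega_gt0 : 0 < omega) (k_def : k = omega / v)
    (M_transfer : is_transfer_matrix xL xR c v delta omega M)
    (lambda_eig : are_eigenvalues (modified_transfer_matrix L k M) lambda)
    (i : 'I_2) (u : R -> R[i])
    (u_mode : is_eigenmode L xL xR c v delta omega
                (modified_transfer_matrix L k M) (lambda i) u)
    (theta : R) (theta_arg : is_arg (lambda i) theta) :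
  let beta := - (L^-1 * ln (cabs (lambda i))) in
  let alpha := L^-1 * theta in
  forall x : R, u (x + L) = cexp ('i%C * (alpha +i* beta) * L%:C) * u x.
Proof.
move=> beta alpha x; case: cell => xLR xRL _ gap.
rewrite {}k_def in u_mode *.
have [lam0 qp] := eigenmode_quasiperiodic L_gt0 v_gt0 c_gt0 delta_gt0 omega_gt0
  xLR xRL gap M_transfer u_mode.
by rewrite cexp_arg_log.
Qed.
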